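(* Assume there is $L_m>0$ with $\|J(\mu,\cdot)-J(\nu,\cdot)\|_\infty\le L_mW_1(\mu,\nu)$ for all $\mu,\nu\in\mathcal P(\Omega)$. Let $\varepsilon>0$ and let $\mu^\varepsilon\in\mathcal P(\Omega)$ satisfy the $\varepsilon$-Minty variational inequality $$\langle J(\eta,\cdot),\eta-\mu^\varepsilon\rangle\ge-\varepsilon\qquad\forall\,\eta\in\mathcal P(\Omega).$$ Assume in addition that $\varepsilon\le2L_mD_\Omega$. Then $\mu^\varepsilon$ satisfies the $\delta$-variational inequality $$\langle J(\mu^\varepsilon,\cdot),\eta-\mu^\varepsilon\rangle\ge-\delta\qquad\forall\,\eta\in\mathcal P(\Omega),$$ with $\delta=2\sqrt{2L_mD_\Omega\,\varepsilon}$.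
   Context: $\Omega\subset\mathbb R^d$ is a nonempty compact set, $D_\Omega:=\sup_{x,y\in\Omega}|x-y|$, $\mathcal P(\Omega)$ is the set of Borel probability measures on $\Omega$, and $J:\mathcal P(\Omega)\times\Omega\to\mathbb R$ is such that $J(\mu,\cdot)\in C(\Omega)$ for every $\mu\in\mathcal P(\Omega)$. For $f\in C(\Omega)$ and a finite signed measure $\xi$, $\langle f,\xi\rangle:=\int_\Omega f\,d\xi$. $W_1$ is the 1-Wasserstein distance on $\mathcal P(\Omega)$ for the Euclidean distance. *)

(* Defs.v *)
From HB Require Import structures.
From mathcomp Require Import all_boot all_order all_algebra.
From mathcomp Require Import all_classical all_reals all_analysis.

Set Implicit Arguments.
Unset Strict Implicit.
Unset Printing Implicit Defensive.

Import Order.TTheory GRing.Theory Num.Theory.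
Import numFieldNormedType.Exports.

Local Open Scope classical_set_scope.
Local Open Scope ring_scope.

(* The norm that 'rV[R]_d carries in the library is the sup norm; it induces
   the usual topology, but distances here are Euclidean. *)
Definition eucl_norm (R : realType) (d : nat) (x : 'rV[R]_d) : R :=
  Num.sqrt (\sum_(i < d) x 0 i ^+ 2).

Definition eucl_diam (R : realType) (d : nat) (Omega : set 'rV[R]_d) : R :=
  sup [set eucl_norm (x - y) | x in Omega & y in Omega].

(* The set Omega as a type, with the topology induced by R^d and the Borel
   sigma-algebra of that topology. The nonemptiness proof is a parameter because
   the library's measurable types are pointed. *)
Definition domain (R : realType) (d : nat) (Omega : set 'rV[R]_d)
  (Omega0 : Omega !=set0) : Type := set_type Omega.

Definition domain_point (R : realType) (d : nat) (Omega : set 'rV[R]_d)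
    (Omega0 : Omega !=set0) : domain Omega0 :=
  let: exist x Ox := cid Omega0 in SigSub (mem_set Ox).

Section domain_structures.
Context (R : realType) (d : nat) (Omega : set 'rV[R]_d).
Variable Omega0 : Omega !=set0.

HB.instance Definition _ :=
  Topological.copy (domain Omega0) (set_type Omega).

HB.instance Definition _ :=
  isPointed.Build (domain Omega0) (domain_point Omega0).

HB.instance Definition _ :=
  Measurable.copy (domain Omega0)
    (g_sigma_algebraType (@open (domain Omega0))).

End domain_structures.

Definition domain_val (R : realType) (d : nat) (Omega : set 'rV[R]_d)
  (Omega0 : Omega !=set0) (x : domain Omega0) : 'rV[R]_d := set_val x.

Definition sup_norm (R : realType) (T : Type) (f : T -> R) : R :=
  sup [set `|f x| | x in [set: T]].

Section pairing.
Context (disp : measure_display) (T : measurableType disp) (R : realType).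

Definition hahn_pos (xi : {charge set T -> \bar R}) : set T :=
  projT1 (cid (Hahn_decomposition xi)).

Definition hahn_neg (xi : {charge set T -> \bar R}) : set T :=
  projT1 (cid (projT2 (cid (Hahn_decomposition xi)))).

Lemma hahn_pos_neg (xi : {charge set T -> \bar R}) :
  hahn_decomposition xi (hahn_pos xi) (hahn_neg xi).
Proof. exact: projT2 (cid (projT2 (cid (Hahn_decomposition xi)))). Qed.

(* The integral of f against xi, that is, against xi^+ minus against xi^-; the
   Jordan parts do not depend on the chosen Hahn decomposition. *)
Definition pairing (f : T -> R) (xi : {charge set T -> \bar R}) : R :=
  \int[jordan_pos (hahn_pos_neg xi)]_x f x
  - \int[jordan_neg (hahn_pos_neg xi)]_x f x.

Definition prob_sub (eta mu : probability T R) : {charge set T -> \bar R} :=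
  cadd (charge_of_finite_measure eta) (copp (charge_of_finite_measure mu)).

Definition coupling (mu nu : probability T R)
    (pi : probability (T * T)%type R) : Prop :=
  (forall A : set T, measurable A -> pi (fst @^-1` A) = mu A) /\
  (forall A : set T, measurable A -> pi (snd @^-1` A) = nu A).

End pairing.

Definition W1 (R : realType) (d : nat) (Omega : set 'rV[R]_d)
    (Omega0 : Omega !=set0) (mu nu : probability (domain Omega0) R) : \bar R :=
  ereal_inf
    [set (\int[pi]_z (eucl_norm (domain_val z.1 - domain_val z.2))%:E)%E
      | pi in coupling mu nu].

(* Main.v *)
Require Import Defs.
From HB Require Import structures.
From mathcomp Require Import all_boot all_order all_algebra.
From mathcomp Require Import all_classical all_reals all_analysis.
From mathcomp Require Import measurable_realfun ring lra.

(** Why the theorem is true. Write D for the diameter, <f, b - a> for the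
    pairing, and test the Minty inequality on the segment
    nu_t := (1 - t) mu_eps + t eta with 0 < t <= 1. Since
    nu_t - mu_eps = t (eta - mu_eps), it says
    <J(nu_t), eta - mu_eps> >= - eps / t. To replace J(nu_t) by J(mu_eps),
    observe that only a fraction t of the mass has to move between nu_t and
    mu_eps, so that W1(nu_t, mu_eps) <= t D ([W1_mixture_le]). The Lipschitz
    hypothesis bounds |J(nu_t) - J(mu_eps)| by Lm t D uniformly, and integrating
    against two probability measures costs at most 2 Lm t D. Hence
    <J(mu_eps), eta - mu_eps> >= - (eps / t + 2 Lm D t). The right-hand side is
    best for t = sqrt (eps / (2 Lm D)), where both terms are equal to
    sqrt (2 Lm D eps); the condition eps <= 2 Lm D is what makes this t at
    most 1.

    The pairing is the integral against the Jordan parts of eta - mu_eps; it is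
    reduced to a difference of two integrals in [pairing_prob_sub]. Compactness
    of the domain makes continuous functions bounded, so that all integrals are
    finite and [sup_norm] is a genuine upper bound, and makes the diameter an
    upper bound of the distances. *)

Set Implicit Arguments.
Unset Strict Implicit.
Unset Printing Implicit Defensive.

Import Order.TTheory GRing.Theory Num.Theory.
Import numFieldNormedType.Exports.

Local Open Scope classical_set_scope.
Local Open Scope ring_scope.

(** * Bounded functions and the pairing *)

Section finite_measure_integral.
Context (disp : measure_display) (T : measurableType disp) (R : realType).
Implicit Types (f : T -> R).

Lemma integrable_of_bound (mu : {finite_measure set T -> \bar R}) f (M : R) :
  measurable_fun [set: T] f -> (forall x, `|f x| <= M) ->
  mu.-integrable [set: T] (EFin \o f).
Proof.
move=> mf fM; apply: measurable_bounded_integrable => //.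
  exact: fin_num_fun_lty (@fin_num_measure _ _ _ mu).
exists M; split; first exact: num_real.
by move=> N MN x _; exact: le_trans (fM x) (ltW MN).
Qed.

Lemma Rintegral_measure_add (m1 m2 : {measure set T -> \bar R}) f :
  measurable_fun [set: T] f ->
  m1.-integrable [set: T] (EFin \o f) -> m2.-integrable [set: T] (EFin \o f) ->
  \int[measure_add m1 m2]_x f x = \int[m1]_x f x + \int[m2]_x f x.
Proof.
move=> mf f1 f2; rewrite /Rintegral integral_measure_add//.
by rewrite fineD//; exact: integrable_fin_num.
Qed.

(** The Jordan parts satisfy a - b = jp - jn, that is a + jn = jp + b, an
    identity between nonnegative finite measures: integrating f against both
    sides and rearranging gives the result without describing jp and jn. *)
Lemma pairing_prob_sub (a b : probability T R) f (M : R) :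
  measurable_fun [set: T] f -> (forall x, `|f x| <= M) ->
  pairing f (prob_sub a b) = \int[a]_x f x - \int[b]_x f x.
Proof.
move=> mf fM; rewrite /pairing.
set jp := jordan_pos _; set jn := jordan_neg _.
have fI (mu : {finite_measure set T -> \bar R}) :
    mu.-integrable [set: T] (EFin \o f) by exact: integrable_of_bound fM.
suff : \int[a]_x f x + \int[jn]_x f x = \int[jp]_x f x + \int[b]_x f x.
  by lra.
rewrite -!Rintegral_measure_add//; [|exact: fI..].
rewrite /Rintegral; congr (fine _).
apply: eq_measure_integral => A mA _.
transitivity (a A + jn A)%E; first exact: measure_addE.
transitivity (jp A + b A)%E; last exact/esym/measure_addE.
have : (a A - b A)%E = (jp A - jn A)%E.
  have := jordan_decomp (hahn_pos_neg (prob_sub a b)) mA.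
  rewrite /cadd /= cscaleN1 => <-.
  by rewrite /copp /= ?cscaleN1.
have : a A \is a fin_num by exact: fin_num_measure.
have : b A \is a fin_num by exact: fin_num_measure.
have : jp A \is a fin_num by exact: fin_num_measure.
have : jn A \is a fin_num by exact: fin_num_measure.
(* All values are finite, so the identity can be rearranged in R. *)
case: (a A) (b A) (jp A) (jn A) => [x||] [y||] [z||] [w||]// _ _ _ _.
by rewrite -!EFinN -!EFinD => -[xyzw]; congr EFin; lra.
Qed.

Lemma Rintegral_prob_cst (a : probability T R) (r : R) : \int[a]_x r = r.
Proof. by rewrite Rintegral_cst//= probability_setT mulr1. Qed.

Lemma Rintegral_prob_le (a : probability T R) f (M : R) :
  measurable_fun [set: T] f -> (forall x, `|f x| <= M) ->
  `|\int[a]_x f x| <= M.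
Proof.
move=> mf fM.
have fI : a.-integrable [set: T] (EFin \o f) by exact: integrable_of_bound fM.
apply: le_trans (le_normr_Rintegral _ fI) _ => //.
apply: (@le_trans _ _ (\int[a]_x M)); last first.
  by rewrite Rintegral_prob_cst.
apply: le_Rintegral => //; first exact: (integrable_norm fI).
apply: (@integrable_of_bound _ _ `|M|); last by [].
exact: measurable_cst.
Qed.

End finite_measure_integral.

(** * Convex combinations of probability measures *)

Section mixture.
Context (disp : measure_display) (T : measurableType disp) (R : realType).
Implicit Types (t : {i01 R}) (a b : probability T R).

Definition mixture t a b : set T -> \bar R :=
  measure_add (mscale (1 - t%:num)%:nng a) (mscale t%:num%:nng b).

HB.instance Definition _ t a b := Measure.on (mixture t a b).

Lemma mixtureE t a b (A : set T) :
  mixture t a b A = ((1 - t%:num)%:E * a A + t%:num%:E * b A)%E.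
Proof. by rewrite /mixture measure_addE. Qed.

Let mixture_setT t a b : mixture t a b [set: T] = 1%E.
Proof. by rewrite mixtureE !probability_setT !mule1 -EFinD subrK. Qed.

HB.instance Definition _ t a b :=
  Measure_isProbability.Build _ _ _ (mixture t a b) (mixture_setT t a b).

Lemma ge0_integral_mixture t a b (f : T -> \bar R) :
  measurable_fun [set: T] f -> (forall x, 0 <= f x)%E ->
  (\int[mixture t a b]_x f x
   = (1 - t%:num)%:E * \int[a]_x f x + t%:num%:E * \int[b]_x f x)%E.
Proof.
move=> mf f0; rewrite /mixture ge0_integral_measure_add//.
by rewrite !ge0_integral_mscale.
Qed.

(** Reduced to nonnegative integrands by adding the bound M, which shifts the
    integral against any probability measure by M. *)
Lemma Rintegral_mixture t a b (f : T -> R) (M : R) :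
  measurable_fun [set: T] f -> (forall x, `|f x| <= M) ->
  \int[mixture t a b]_x f x
  = (1 - t%:num) * \int[a]_x f x + t%:num * \int[b]_x f x.
Proof.
move=> mf fM.
have fI (p : probability T R) : p.-integrable [set: T] (EFin \o f).
  exact: integrable_of_bound fM.
have MI (p : probability T R) : p.-integrable [set: T] (EFin \o cst M).
  by apply: (@integrable_of_bound _ _ _ _ _ `|M|) => //; exact: measurable_cst.
have intDM (p : probability T R) :
    (\int[p]_x (f x + M)%:E)%E = (\int[p]_x f x + M)%:E.
  rewrite -[LHS]fineK; last first.
    have := integrableD measurableT (fI p) (MI p).
    by move=> /(integrable_fin_num measurableT).
  congr EFin; rewrite -[LHS]/(\int[p]_x (f x + M)) RintegralD//.
  - by rewrite Rintegral_prob_cst.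
  - exact: fI.
  - exact: MI.
have mfM : measurable_fun [set: T] (fun x => (f x + M)%:E).
  by apply/measurable_EFinP; exact: measurable_funD.
have fM0 x : (0 <= (f x + M)%:E)%E.
  by rewrite lee_fin; have := fM x; rewrite ler_norml; lra.
have := ge0_integral_mixture t a b mfM fM0.
rewrite (intDM (mixture t a b)) !intDM -!EFinM -EFinD => -[].
lra.
Qed.

End mixture.

(** * A coupling of a mixture with one of its components *)

Section coupling_mixture.
Context (disp : measure_display) (T : measurableType disp) (R : realType).
Implicit Types (t : {i01 R}) (a b : probability T R).

Definition diag (x : T) : T * T := (x, x).

Let measurable_diag : measurable_fun [set: T] diag.
Proof. exact: measurable_fun_pair. Qed.

HB.instance Definition _ :=
  isMeasurableFun.Build _ _ _ _ diag measurable_diag.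

Definition independent_coupling a b : set (T * T) -> \bar R := (a \x b)%E.

HB.instance Definition _ a b := Measure.on (independent_coupling a b).

Lemma independent_couplingE a b (A B : set T) :
  measurable A -> measurable B ->
  independent_coupling a b (A `*` B) = (a A * b B)%E.
Proof. exact: product_measure1E. Qed.

Let independent_coupling_setT a b :
  independent_coupling a b [set: T * T] = 1%E.
Proof. by rewrite -setXTT independent_couplingE// !probability_setT mule1. Qed.

HB.instance Definition _ a b := Measure_isProbability.Build _ _ _
  (independent_coupling a b) (independent_coupling_setT a b).

(** The coupling of [a] with itself that moves no mass. *)
Definition diag_coupling a : probability (T * T)%type R :=
  distribution a (diag : {mfun T >-> (T * T)%type}).

(** The common part (1 - t) a stays in place; the remaining mass t is sent from
    [b] to [a] by the product plan. *)
Lemma coupling_mixture t a b :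
  coupling (mixture t a b) a
    (mixture t (diag_coupling a) (independent_coupling b a)).
Proof.
split=> A mA.
- have ind : independent_coupling b a (fst @^-1` A) = b A.
    rewrite (_ : fst @^-1` A = A `*` [set: T]).
      by rewrite independent_couplingE// probability_setT mule1.
    by apply/seteqP; split=> -[x y]//= [].
  rewrite [RHS]mixtureE -ind.
  exact: mixtureE.
- have ind : independent_coupling b a (snd @^-1` A) = a A.
    rewrite (_ : snd @^-1` A = [set: T] `*` A).
      by rewrite independent_couplingE// probability_setT mul1e.
    by apply/seteqP; split=> -[x y]//= [].
  transitivity ((1 - t%:num)%:E * a A + t%:num%:E * a A)%E.
    rewrite -[in X in (_ + X)%E]ind.
    exact: mixtureE.
  by rewrite -ge0_muleDl ?lee_fin// -EFinD subrK mul1e.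
Qed.

(** The diagonal part of the plan is free, and the product part, of mass t,
    costs at most D per unit of mass. *)
Lemma transport_cost_mixture_le t a b (c : T * T -> R) (D : R) :
  measurable_fun [set: T * T] c -> (forall z, 0 <= c z) ->
  (forall x, c (x, x) = 0) -> (forall z, c z <= D) ->
  (\int[mixture t (diag_coupling a) (independent_coupling b a)]_z (c z)%:E
   <= (t%:num * D)%:E)%E.
Proof.
move=> mc c0 cxx cD.
rewrite ge0_integral_mixture//; last exact/measurable_EFinP.
have -> : (\int[diag_coupling a]_z (c z)%:E = 0)%E.
  rewrite /diag_coupling ge0_integral_distribution//; last first.
    exact/measurable_EFinP.
  by apply: integral0_eq => x _ /=; rewrite cxx.
rewrite mule0 add0e EFinM lee_wpmul2l ?lee_fin//.
apply: (@le_trans _ _ (\int[independent_coupling b a]_z D%:E)%E).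
  apply: ge0_le_integral => //.
  - by move=> z _; rewrite lee_fin.
  - exact/measurable_EFinP.
  - by move=> z _; rewrite lee_fin.
by rewrite integral_cst//= probability_setT mule1.
Qed.

End coupling_mixture.

(** * Continuous functions and distances on a compact domain *)

Section compact_domain.
Context (R : realType) (d : nat) (Omega : set 'rV[R]_d).
Context (Omega0 : Omega !=set0) (cOmega : compact Omega).

Lemma continuous_domain_bounded (f : domain Omega0 -> R) : continuous f ->
  exists M, forall x, `|f x| <= M.
Proof.
move=> cf.
(* Extended by 0 outside Omega, f is continuous within the compact set Omega. *)
have cg : {within Omega, continuous (valL_ 0 (f : set_type Omega -> R))}.
  exact/subspace_valL_continuousP'.
have /compact_bounded[M [_ fM]] := continuous_compact cg cOmega.
exists (M + 1) => x; apply: (fM (M + 1)); first by rewrite ltrDl.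
exists (domain_val x); first exact: set_valP.
by rewrite /= -[LHS]/(sigL Omega (valL_ 0 f) x) valLK.
Qed.

Lemma continuous_domain_measurable (f : domain Omega0 -> R) : continuous f ->
  measurable_fun [set: domain Omega0] f.
Proof.
move=> /continuousP cf; apply: (measurability _ (RGenOpens.measurableE R)).
move=> _ [_ [a [b ->] <-]]; rewrite setTI.
by apply: sub_sigma_algebra; exact/cf/interval_open.
Qed.

Lemma continuous_domain_val : continuous (@domain_val R d Omega Omega0).
Proof. exact: initial_continuous. Qed.

Lemma measurable_eucl_dist : measurable_fun [set: domain Omega0 * domain Omega0]
  (fun z => eucl_norm (domain_val z.1 - domain_val z.2)).
Proof.
have mcoord i : measurable_fun [set: domain Omega0] (fun x => domain_val x 0 i).
  apply: continuous_domain_measurable => x.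
  apply: (@continuous_comp _ _ _ (@domain_val R d Omega Omega0)
    (fun v : 'rV[R]_d => v 0 i)); first exact: continuous_domain_val.
  exact: coord_continuous.
rewrite /eucl_norm; apply: measurableT_comp.
  by apply: continuous_measurable_fun; exact: sqrt_continuous.
apply: measurable_sum => i; under eq_fun do rewrite !mxE.
apply: measurable_funX; apply: measurable_funB.
  exact: measurableT_comp (mcoord i) measurable_fst.
exact: measurableT_comp (mcoord i) measurable_snd.
Qed.

(** A supremum is an upper bound only of a bounded set: the squared norm S is
    bounded on the compact Omega, and (x - y)^2 <= 2 x^2 + 2 y^2
    coordinatewise. *)
Lemma eucl_dist_le_diam (x y : 'rV[R]_d) : Omega x -> Omega y ->
  eucl_norm (x - y) <= eucl_diam Omega.
Proof.
move=> Ox Oy; apply: ub_le_sup; last by exists x => //; exists y.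
pose S v : R := \sum_(i < d) (v : 'rV[R]_d) 0 i ^+ 2.
have cS : continuous S.
  rewrite /S; apply: continuous_big => [|i _ v]; first exact: add_continuous.
  by apply: (@cvgM _ _ (nbhs v)); exact: coord_continuous.
have : {within Omega, continuous S} by exact: continuous_subspaceT.
move=> /continuous_compact/(_ cOmega)/compact_bounded[M [_ SM]].
have {}SM v : Omega v -> S v <= M + 1.
  move=> Ov; apply: le_trans (ler_norm _) _.
  by apply: SM; [rewrite ltrDl|exists v].
exists (Num.sqrt (2 * (M + 1) + 2 * (M + 1))) => _ [u Ou [v Ov] <-].
rewrite /eucl_norm ler_wsqrtr//.
apply: (@le_trans _ _ (2 * S u + 2 * S v)); last first.
  by rewrite lerD// ler_wpM2l// SM.
rewrite /S !mulr_sumr -big_split ler_sum// => i _ /=; rewrite !mxE.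
rewrite -subr_ge0 (_ : _ - _ = (u 0 i + v 0 i) ^+ 2) ?sqr_ge0//; ring.
Qed.

Lemma W1_mixture_le (t : {i01 R}) (a b : probability (domain Omega0) R) :
  (W1 (mixture t a b) a <= (t%:num * eucl_diam Omega)%:E)%E.
Proof.
apply: ge_ereal_inf; eexists.
  by eexists; [exact: coupling_mixture|reflexivity].
apply: (@transport_cost_mixture_le _ _ _ _ _ _
  (fun z => eucl_norm (domain_val z.1 - domain_val z.2))).
- exact: measurable_eucl_dist.
- by move=> z; exact: sqrtr_ge0.
- move=> x /=; rewrite subrr /eucl_norm big1 ?sqrtr0// => i _.
  by rewrite mxE expr0n.
- by move=> z; apply: eucl_dist_le_diam; exact: set_valP.
Qed.

Lemma le_sup_norm (f : domain Omega0 -> R) x : continuous f ->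
  `|f x| <= sup_norm f.
Proof.
move=> /continuous_domain_bounded[M fM].
apply: ub_le_sup; last by exists x.
by exists M => _ [y _ <-].
Qed.

End compact_domain.

(** * From the Minty inequality to the variational inequality *)

Theorem proposition3p5 (R : realType) (d : nat) (Omega : set 'rV[R]_d)
    (Omega0 : Omega !=set0) (cOmega : compact Omega)
    (J : probability (domain Omega0) R -> domain Omega0 -> R)
    (J_cont : forall mu : probability (domain Omega0) R, continuous (J mu))
    (Lm : R) (Lm_gt0 : 0 < Lm)
    (J_lip : forall mu nu : probability (domain Omega0) R,
      ((sup_norm (fun x => J mu x - J nu x))%:E <= Lm%:E * W1 mu nu)%E)
    (eps : R) (eps_gt0 : 0 < eps)
    (mu_eps : probability (domain Omega0) R)
    (minty : forall eta : probability (domain Omega0) R,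
      pairing (J eta) (prob_sub eta mu_eps) >= - eps)
    (eps_le : eps <= 2 * Lm * eucl_diam Omega) :
  forall eta : probability (domain Omega0) R,
    pairing (J mu_eps) (prob_sub eta mu_eps)
      >= - (2 * Num.sqrt (2 * Lm * eucl_diam Omega * eps)).
Proof.
move=> eta; set D := eucl_diam Omega in eps_le *; set K := 2 * Lm * D.
have K0 : 0 < K by exact: lt_le_trans eps_le.
have pairingE (f : domain Omega0 -> R) (cf : continuous f)
    (a b : probability (domain Omega0) R) :
    pairing f (prob_sub a b) = \int[a]_x f x - \int[b]_x f x.
  have [M fM] := continuous_domain_bounded cOmega cf.
  exact: pairing_prob_sub (continuous_domain_measurable cf) fM.
(* The minimizer of eps / t + K t. *)
pose t := Num.sqrt (eps / K).
have t0 : 0 < t by rewrite sqrtr_gt0 divr_gt0.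
have t1 : t <= 1 by rewrite -sqrtr1 ler_wsqrtr// ler_pdivrMr// mul1r.
pose ti : {i01 R} := Itv01 (ltW t0) t1.
pose nu : probability (domain Omega0) R := mixture ti mu_eps eta.
pose I (p : probability (domain Omega0) R) f : R := \int[p]_x f x.
have [M JnuM] := continuous_domain_bounded cOmega (J_cont nu).
have mJ mu := continuous_domain_measurable (J_cont mu).
(* The pairing of J nu with nu - mu_eps is t times that with eta - mu_eps. *)
have minty_t : - eps <= t * (I eta (J nu) - I mu_eps (J nu)).
  have := minty nu; rewrite pairingE//.
  rewrite (Rintegral_mixture _ _ _ (mJ nu) JnuM) /= -/(I _ _) -/(I _ _).
  by lra.
have [N JmuN] := continuous_domain_bounded cOmega (J_cont mu_eps).
pose g x := J nu x - J mu_eps x.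
have cg : continuous g.
  by move=> x; apply: (@cvgB _ _ _ (nbhs x)); exact: J_cont.
have gle x : `|g x| <= Lm * (t * D).
  apply: le_trans (le_sup_norm cOmega x cg) _.
  rewrite -lee_fin (le_trans (J_lip nu mu_eps))// EFinM.
  by rewrite lee_wpmul2l ?lee_fin ?(ltW Lm_gt0)//; exact: W1_mixture_le.
have mg := continuous_domain_measurable cg.
have gB p : I p g = I p (J nu) - I p (J mu_eps).
  by apply: RintegralB => //; [exact: integrable_of_bound JnuM|
    exact: integrable_of_bound JmuN].
have := Rintegral_prob_le eta mg gle; rewrite -/(I _ _) ler_norml gB.
have := Rintegral_prob_le mu_eps mg gle; rewrite -/(I _ _) ler_norml gB.
move=> /andP[mu1 mu2] /andP[eta1 eta2].
(* By the choice of t, eps / t and K t are both equal to sqrt (K eps). *)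
have sqrtE : Num.sqrt (K * eps) = K * t.
  rewrite -[K in RHS]gtr0_norm// -sqrtr_sqr -sqrtrM ?sqr_ge0//.
  by congr Num.sqrt; field; rewrite gt_eqF.
have epsE : eps = K * t * t.
  by rewrite -mulrA -expr2 sqr_sqrtr ?divr_ge0 ?ltW// mulrC divfK// gt_eqF.
rewrite sqrtE pairingE// -!/(I _ _).
have {}minty_t : - (K * t) <= I eta (J nu) - I mu_eps (J nu).
  by rewrite -(ler_pM2l t0); lra.
rewrite /K in minty_t *; lra.
Qed.
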